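(* Let $E$ and $\partial E$ be Banach spaces and let $A_m:D(A_m)\subseteq E\to E$, $B:D(B)\subseteq\partial E\to\partial E$ and $L:D(A_m)\to\partial E$ be linear operators such that (i) $A:=A_m|_{\ker L}$ generates a strongly continuous semigroup $(T(t))_{t\ge0}$ on $E$; (ii) $L:D(A_m)\to\partial E$ is surjective; (iii) $\binom{A_m}{L}:D(A_m)\to E\times\partial E$ is closed; (iv) $B$ generates a strongly continuous semigroup $(S(t))_{t\ge0}$ on $\partial E$. Assume in addition that $0\in\rho(A)$ and $D(A_m)\subset\mathrm{Fav}_1(A)$. On $\mathcal{E}=E\times\partial E$ consider the operators $$\mathcal{A}_0=\begin{pmatrix}A_m&0\\0&B\end{pmatrix},\quad D(\mathcal{A}_0)=\bigl\{\tbinom fx\in D(A_m)\times D(B):Lf=x\bigr\},$$ $$\mathcal{A}_1=\begin{pmatrix}A_m&0\\0&0\end{pmatrix},\quad D(\mathcal{A}_1)=\bigl\{\tbinom fx\in D(A_m)\times\partial E:Lf=x\bigr\},\qquad \mathcal{A}_2=\begin{pmatrix}0&0\\0&B\end{pmatrix},\quad D(\mathcal{A}_2)=E\times D(B),$$ so that $\mathcal{A}_0=\mathcal{A}_1+\mathcal{A}_2$, and let $(\mathcal{T}_i(t))_{t\ge0}$ be the semigroup generated by $\mathcal{A}_i$, $i=0,1,2$. Then for all $z\in\mathcal{E}$ and $t\ge0$ $$\mathcal{T}_0(t)z=\lim_{n\to\infty}\bigl(\mathcal{T}_2(\tfrac tn)\mathcal{T}_1(\tfrac tn)\bigr)^nz\quad\text{and}\quad\mathcal{T}_0(t)z=\lim_{n\to\infty}\bigl(\mathcal{T}_1(\tfrac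 t{2n})\mathcal{T}_2(\tfrac tn)\mathcal{T}_1(\tfrac t{2n})\bigr)^nz.$$
   Context: $A_m|_{\ker L}$ is the restriction of $A_m$ to the domain $\ker L\subseteq D(A_m)$. The Favard class of $A$ is $\mathrm{Fav}_1(A):=\{x\in E:\sup_{t\in(0,1]}t^{-1}\|T(t)x-x\|<\infty\}$. Under the stated assumptions, $\mathcal{A}_0$, $\mathcal{A}_1$, $\mathcal{A}_2$ generate strongly continuous semigroups on $\mathcal{E}$. *)

(* Defs.v *)
From HB Require Import structures.
From mathcomp Require Import all_boot all_order all_algebra.
From mathcomp Require Import all_classical all_reals all_analysis.
From mathcomp Require Import complex.

Set Implicit Arguments.
Unset Strict Implicit.
Unset Printing Implicit Defensive.

Import Order.TTheory GRing.Theory Num.Theory.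
Import numFieldNormedType.Exports.

Local Open Scope classical_set_scope.
Local Open Scope ring_scope.

Variant scalar_kind := RealScalars | ComplexScalars.

(* The scalar field of the Banach spaces: the reals or the complex numbers.   *)
(* In both cases the elements [t] with [0 <= t] are exactly the nonnegative   *)
(* reals (the order of R[i] is partial: [0 <= t] forces t to be real), so     *)
(* they serve as the time parameters of semigroups. Likewise, norms take      *)
(* their values in the scalar field, as usual for [normedModType].            *)
Definition scalars (R : realType) (k : scalar_kind) : numFieldType :=
  match k with RealScalars => R | ComplexScalars => R[i] end.

Section Operators.
Variable K : numFieldType.

Definition subspace (E : lmodType K) (D : set E) : Prop :=
  D 0 /\ forall (a : K) (x y : E), D x -> D y -> D (a *: x + y).

(* Linear maps D -> F on a subspace D of E; the values of the underlying total *)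
(* function outside D are irrelevant.                                         *)
Record linear_on (E F : lmodType K) (D : set E) := LinearOn {
  linear_on_fun :> E -> F;
  linear_onP : forall (a : K) (x y : E), D x -> D y ->
    linear_on_fun (a *: x + y) = a *: linear_on_fun x + linear_on_fun y }.

Record operator (E F : lmodType K) := Operator {
  dom : set E;
  dom_subspace : subspace dom;
  op :> linear_on F dom }.

Section Kernel.
Variables (E F G : lmodType K) (A : operator E F) (L : linear_on G (dom A)).

Let ker_dom : set E := [set f | dom A f /\ L f = 0].

Let ker_subspace : subspace ker_dom.
Proof.
have [D0 DP] := dom_subspace A; split.
  split=> //; have := linear_onP L (-1) D0 D0.
  by rewrite scaler0 addr0 scaleN1r addNr.
move=> a x y [Dx Lx] [Dy Ly]; split; first exact: DP.
by rewrite linear_onP// Lx Ly scaler0 addr0.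
Qed.

Let ker_linear (a : K) (x y : E) : ker_dom x -> ker_dom y ->
  A (a *: x + y) = a *: A x + A y.
Proof. by move=> [Dx _] [Dy _]; rewrite linear_onP. Qed.

Definition restrict_ker : operator E F :=
  Operator ker_subspace (LinearOn ker_linear).

End Kernel.

Section OperatorMatrices.
Variables (E F : lmodType K) (Am : operator E E) (B : operator F F).
Variable (L : linear_on F (dom Am)).

Let dom0 : set (E * F) := [set z | [/\ dom Am z.1, dom B z.2 & L z.1 = z.2]].
Let dom1 : set (E * F) := [set z | dom Am z.1 /\ L z.1 = z.2].
Let dom2 : set (E * F) := [set z | dom B z.2].

Let L0 : L 0 = 0.
Proof.
have [D0 _] := dom_subspace Am; have := linear_onP L (-1) D0 D0.
by rewrite scaler0 addr0 scaleN1r addNr.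
Qed.

Let dom0_subspace : subspace dom0.
Proof.
have [D0 DP] := dom_subspace Am; have [D0' DP'] := dom_subspace B.
split=> [|a x y [Dx Bx Lx] [Dy By Ly]]; split=> //=.
- exact: DP.
- exact: DP'.
- by rewrite linear_onP// Lx Ly.
Qed.

Let dom1_subspace : subspace dom1.
Proof.
have [D0 DP] := dom_subspace Am.
split=> [|a x y [Dx Lx] [Dy Ly]]; split=> //=; first exact: DP.
by rewrite linear_onP// Lx Ly.
Qed.

Let dom2_subspace : subspace dom2.
Proof.
have [D0 DP] := dom_subspace B.
by split=> [//|a x y Dx Dy]; exact: DP.
Qed.

Let op0_linear (a : K) (x y : E * F) : dom0 x -> dom0 y ->
  (Am (a *: x + y).1, B (a *: x + y).2) =
  a *: (Am x.1, B x.2) + (Am y.1, B y.2).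
Proof. by move=> [? ? _] [? ? _]; rewrite !linear_onP. Qed.

Let op1_linear (a : K) (x y : E * F) : dom1 x -> dom1 y ->
  (Am (a *: x + y).1, 0 : F) = a *: (Am x.1, 0) + (Am y.1, 0).
Proof.
by move=> [? _] [? _]; rewrite linear_onP//; congr pair; rewrite /= scaler0 addr0.
Qed.

Let op2_linear (a : K) (x y : E * F) : dom2 x -> dom2 y ->
  (0 : E, B (a *: x + y).2) = a *: (0, B x.2) + (0, B y.2).
Proof.
by move=> ? ?; rewrite linear_onP//; congr pair; rewrite /= scaler0 addr0.
Qed.

Definition calA0 : operator (E * F)%type (E * F)%type :=
  @Operator _ _ dom0 dom0_subspace
    (LinearOn (linear_on_fun := fun z => (Am z.1, B z.2)) op0_linear).

Definition calA1 : operator (E * F)%type (E * F)%type :=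
  @Operator _ _ dom1 dom1_subspace
    (LinearOn (linear_on_fun := fun z => (Am z.1, 0)) op1_linear).

Definition calA2 : operator (E * F)%type (E * F)%type :=
  @Operator _ _ dom2 dom2_subspace
    (LinearOn (linear_on_fun := fun z => (0, B z.2)) op2_linear).

Lemma calA0_sum : dom calA0 = dom calA1 `&` dom calA2 /\
  forall z, calA0 z = calA1 z + calA2 z.
Proof.
split; last by move=> z; congr pair; rewrite /= ?addr0 ?add0r.
by apply/seteqP; split=> z => [[? ? ?]|[[? ?] ?]]; do ?split.
Qed.

End OperatorMatrices.

End Operators.

Section Semigroups.
Variables (K : numFieldType) (E : normedModType K).

Definition resolvent_set (A : operator E E) : set K :=
  [set l | exists R : {linear E -> E},
    [/\ continuous R,
        forall y, dom A (R y) /\ l *: R y - A (R y) = y &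
        forall x, dom A x -> R (l *: x - A x) = x]].

(* A semigroup is a family indexed by times [t] with [0 <= t]; its values at   *)
(* all other scalars are irrelevant.                                          *)
Definition C0_semigroup (T : K -> {linear E -> E}) : Prop :=
  [/\ forall t, 0 <= t -> continuous (T t),
      forall x, T 0 x = x,
      forall s t x, 0 <= s -> 0 <= t -> T (s + t) x = T s (T t x) &
      forall x, {within [set t : K | 0 <= t], continuous (fun t => T t x)}].

Definition generates (A : operator E E) (T : K -> {linear E -> E}) : Prop :=
  C0_semigroup T /\
  forall x y, (dom A x /\ A x = y) <->
    (fun h : K => h^-1 *: (T h x - x)) @ 0^'+ --> y.

(* The Favard class Fav_1 of the generator of [T].                            *)
Definition Fav1 (T : K -> {linear E -> E}) : set E :=
  [set x | has_ubound [set t^-1 * `|T t x - x| | t in [set t : K | 0 < t <= 1]]].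

End Semigroups.

(* Main.v *)
From HB Require Import structures.
Require Import Defs.
From mathcomp Require Import all_boot all_order all_algebra.
From mathcomp Require Import all_classical all_reals all_analysis.
From mathcomp Require Import complex ssrAC ring.

Set Implicit Arguments.
Unset Strict Implicit.
Unset Printing Implicit Defensive.

Import Order.TTheory GRing.Theory Num.Theory.
Import numFieldNormedType.Exports.

Local Open Scope classical_set_scope.
Local Open Scope ring_scope.

(** Why the splitting converges. Write V(h) = T2(h) T1(h). The argument is the
principle that a stable and consistent scheme converges, applied to orbits of
T0 that start in the domain of A0.

Stability. Since 0 is in the resolvent set of A, every x in dE is L p for some
p in the kernel of Am ([dirichlet_lift]). The pair (p, x) is then in the kernel
of A1, hence fixed by T1, while T1 extends T on E x {0}. So
  T1(h)(f, x) = (T(h) f + p - T(h) p, x)  and  T2(h)(f, x) = (f, S(h) x)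
([T1E], [T2E]). As p is in the Favard class of A, the difference p - T(h) p is
O(h) for each fixed x, and the uniform boundedness principle gives
|p - T(h) p| <= q h |x| ([lift_defect_bounded]). Thus V(h) is an O(h) lower
order perturbation of the diagonal semigroup (T(h), S(h)), and in V(h)^n the n
perturbations of size O(h) = O(t/n) add up to a bounded operator
([triangular_stable], [lie_splitting_stable]).

Consistency. The domain of A0 is the intersection of those of A1 and A2, and
A0 = A1 + A2 there. For z in it, the curves Ai T0(s) z are components of
A0 T0(s) z = T0(s) A0 z, so they are continuous on [0, t] and have compact
range. By the mean value inequality for semigroups the difference quotients
(Ti(h) - 1)/h converge to Ai along T0(s) z uniformly in s, whence
V(h) T0(s) z - T0(h) T0(s) z = o(h) uniformly in s ([lie_consistency]).

A telescoping sum ([iter_bound_telescope]) turns stability and consistency into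
V(t/n)^n z -> T0(t) z on the domain of A0, which is dense
([generator_dense]); stability extends the limit to all z. The symmetric scheme
is T1(h/2) V(h)^(n-1) T2(h) T1(h/2), so it inherits its limit from V(h)^n.

Semigroup theory is derived from the definition of a generator by limits of
discrete sums: [semigroup_increment] is the mean value inequality, obtained
by cutting [0, r] into small steps, and dyadic means play the part of integral
averages in the proof that generators are densely defined. *)

(** * Real times inside the scalar field *)

(** For a variable field, because as a scalar field [R[i]] carries the topology
that every [numFieldType] has. *)
Lemma cvg_norm_le (K : numFieldType) (T : Type) (F : set_system T)
    (f : T -> K) (y : K) :
  Filter F -> (forall e, 0 < e -> \forall x \near F, `|y - f x| <= e) -> f @ F --> y.
Proof. by move=> FF H; apply/cvgrPdist_le. Qed.

Lemma half_halves (K : numFieldType) (h : K) : h / 2%:R + h / 2%:R = h.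
Proof. by rewrite -splitr. Qed.

Lemma third_sum (F : numFieldType) (e : F) : e = e / 3%:R + e / 3%:R + e / 3%:R.
Proof.
rewrite -!mulrDl (_ : e + e + e = e * 3%:R) ?mulfK ?pnatr_eq0//.
by rewrite mulr_natr 2!mulrSr mulr1n.
Qed.

Section ScalarField.
Variables (R : realType) (k : scalar_kind).
Local Notation K := (scalars R k).

Lemma scalars_archi (x : K) : 0 <= x -> exists n : nat, x <= n%:R.
Proof.
case: k x => /= x x0.
  by exists (Num.bound x); rewrite ltW// archi_boundP.
have xE : x = (complex.Re x)%:C%C.
  by move: x0; rewrite lecE; case: x => a b /= /andP[/eqP-> _].
exists (Num.bound (complex.Re x)); rewrite xE -(rmorph_nat (real_complex R)) lecR ltW//.
by rewrite archi_boundP// -ler0c -xE.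
Qed.

(** In the complex case the segment is the image of a real segment, because the
partial order of [R[i]] makes everything between two reals real. *)
Lemma scalars_segment_compact (t : K) : compact [set s : K | 0 <= s <= t].
Proof.
have [t0|nt0] := boolP (0 <= t); last first.
  rewrite (_ : mkset _ = set0); first exact: compact0.
  apply/seteqP; split=> // s /= /andP[s0 st].
  by move: nt0; rewrite (le_trans s0 st).
case: k t t0 => /= t t0.
  rewrite (_ : mkset _ = `[0, t]%classic); first exact: segment_compact.
  by apply/seteqP; split=> s /=; rewrite in_itv.
have realE (x : R[i]) : 0 <= x -> x = (complex.Re x)%:C%C.
  by rewrite lecE; case: x => a b /= /andP[/eqP-> _].
have -> : [set s : R[i] | 0 <= s <= t] = (real_complex R) @` `[0, complex.Re t]%classic.
  apply/seteqP; split=> [s /= /andP[s0 st]|_ /= [s + <-]].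
    exists (complex.Re s); last by rewrite -realE.
    by rewrite in_itv/= -ler0c -lecR -!realE// s0.
  by rewrite in_itv/= => /andP[s0 st]; rewrite ler0c s0/= (realE t)// lecR.
apply: continuous_compact; last exact: segment_compact.
apply: continuous_subspaceT => x.
apply: cvg_norm_le => e e0; rewrite (realE e) ?ltW//.
have e0' : 0 < complex.Re e by rewrite -ltcR -realE// ltW.
near=> y.
rewrite -rmorphB normc_def/= expr0n addr0 sqrtr_sqr lecR.
by near: y; apply: cvgr_dist_le.
Unshelve. all: by end_near. Qed.

(** Comparability with the multiples of [h] holds because nonnegative scalars are
real. *)
Lemma scalars_floor (r h : K) : 0 <= r -> 0 < h ->
  exists m : nat, m%:R * h <= r <= m%:R * h + h.
Proof.
move=> r0 h0.
have ex : exists n, r <= n%:R * h.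
  have /scalars_archi[n] : 0 <= r / h by rewrite divr_ge0// ltW.
  by rewrite ler_pdivrMr// => rn; exists n.
have realP n : (n%:R * h : K) \is Num.real.
  by rewrite ger0_real// mulr_ge0// ltW.
case: (ex_minnP ex) => -[|m] rm min_m.
  by exists 0; rewrite mul0r add0r r0 (le_trans rm)// mul0r ltW.
exists m; rewrite (_ : _ + h = m.+1%:R * h); last by rewrite -natr1 mulrDl mul1r.
rewrite rm andbT; have [//|/ltW rlem] := real_leP (realP m) (ger0_real r0).
by have := min_m _ rlem; rewrite ltnn.
Qed.

(** The filter of nonnegative times tending to 0. It contains the time 0, unlike
[0^'+], so the estimates below hold for the step [t / n] also when [t = 0]. *)
Definition small_times : set_system K := within [set s : K | 0 <= s] (nbhs 0).

Global Instance small_times_filter : Filter small_times.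
Proof. exact: within_filter. Qed.

Lemma small_times_ge0 : \forall s \near small_times, 0 <= s.
Proof. by rewrite near_withinE; exact: nearW. Qed.

Lemma small_times_le (d : K) : 0 < d -> \forall s \near small_times, s <= d.
Proof.
move=> d0; rewrite near_withinE; near=> s => /= s0.
by rewrite -(ger0_norm s0) ltW//; near: s.
Unshelve. all: by end_near. Qed.

Lemma small_timesP (P : set K) : (\forall s \near small_times, P s) ->
  exists2 d : K, 0 < d & forall s, 0 <= s -> s <= d -> P s.
Proof.
rewrite near_withinE => /nbhs_norm0P[d /= d0 dP]; exists (d / 2%:R); first by rewrite divr_gt0.
move=> s s0 sd; apply: dP => //=; rewrite ger0_norm// (le_lt_trans sd)//.
by rewrite ltr_pdivrMr// ltr_pMr// ltr1n.
Qed.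

Lemma small_times_down (P : set K) : (\forall s \near small_times, P s) ->
  \forall s \near small_times, forall q, 0 <= q <= s -> P q.
Proof.
move=> /small_timesP[d d0 dP].
apply: filterS (small_times_le d0) => s sd q /andP[q0 qs].
exact/dP/(le_trans qs).
Qed.

Lemma cvg_step (t : K) : 0 <= t -> t / n%:R @[n --> \oo] --> small_times.
Proof.
move=> t0 P /small_timesP[d d0 dP].
have /scalars_archi[N tN] : 0 <= t / d by rewrite divr_ge0// ltW.
suff : \forall n \near \oo, P (t / n%:R) by [].
near=> n; have n0 : 0 < n%:R :> K by rewrite ltr0n; near: n; exists 1.
apply: dP; first by rewrite divr_ge0// ltW.
rewrite ler_pdivrMr// mulrC -ler_pdivrMr// (le_trans tN)// ler_nat.
by near: n; exact: nbhs_infty_ge.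
Unshelve. all: by end_near. Qed.

Lemma near_right_small_times (P : set K) :
  (\forall s \near small_times, P s) -> \forall s \near (0 : K)^'+, P s.
Proof.
rewrite near_withinE /at_right near_withinE; apply: filterS => s sP /ltW; exact: sP.
Qed.

End ScalarField.

(** * Completeness of products and uniform boundedness *)

HB.instance Definition _ (U V : puniformType) := Pointed.on (U * V)%type.

Section ProductComplete.
Variables (U V : completeType).

Lemma prod_complete (F : set_system ((U * V)%type : puniformType)) :
  ProperFilter F -> cauchy F -> cvg F.
Proof.
move=> FF Fc.
have Fc1 : cauchy (fst @ F).
  move=> A entA.
  have /Fc : entourage [set xy : (U * V) * (U * V) | A (xy.1.1, xy.2.1)].
    exists (A, setT) => /=; first by split => //; exact: filterT.
    by move=> [[a b] [c d]] [/= Aab _]; exists ((a, c), (b, d)).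
  by move=> [[P Q] [/= FP FQ] PQ]; exists (fst @` P, fst @` Q) => /=;
    [split; [apply: filterS FP|apply: filterS FQ] => x; exists x
    |move=> [_ _] [/= [x Px <-] [y Qy <-]]; exact: (PQ (x, y))].
have Fc2 : cauchy (snd @ F).
  move=> A entA.
  have /Fc : entourage [set xy : (U * V) * (U * V) | A (xy.1.2, xy.2.2)].
    exists (setT, A) => /=; first by split => //; exact: filterT.
    by move=> [[a b] [c d]] [/= _ Aab]; exists ((a, c), (b, d)).
  by move=> [[P Q] [/= FP FQ] PQ]; exists (snd @` P, snd @` Q) => /=;
    [split; [apply: filterS FP|apply: filterS FQ] => x; exists x
    |move=> [_ _] [/= [x Px <-] [y Qy <-]]; exact: (PQ (x, y))].
have /cauchy_cvg/cvg_ex[l Fl] := Fc1.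
have /cauchy_cvg/cvg_ex[m Fm] := Fc2.
apply/cvg_ex; exists (l, m).
move=> P /(cvg_pair Fl Fm); apply: (@filterS _ F) => z /=.
by rewrite -surjective_pairing.
Qed.

HB.instance Definition _ := Uniform_isComplete.Build (U * V)%type prod_complete.
End ProductComplete.

HB.instance Definition _ (K : numFieldType) (U V : completeNormedModType K) :=
  Complete.on (U * V)%type.

Section Sequences.
Variables (R : realType) (k : scalar_kind).
Local Notation K := (scalars R k).

Lemma cvg_halves (t : K) : 0 <= t -> t / 2%:R ^+ n @[n --> \oo] --> @small_times R k.
Proof.
move=> t0 P /small_timesP[d d0 dP].
have /small_timesP[e e0 eP] := small_times_le d0.
have /scalars_archi[N tN] : 0 <= t / d by rewrite divr_ge0// ltW.
suff : \forall n \near \oo, P (t / 2%:R ^+ n) by [].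
near=> n; have n0 : 0 < 2%:R ^+ n :> K by rewrite exprn_gt0.
apply: dP; first by rewrite divr_ge0// ltW.
rewrite ler_pdivrMr// mulrC -ler_pdivrMr// (le_trans tN)// -natrX ler_nat.
apply: leq_trans (ltnW (ltn_expl n _)) => //.
by near: n; exact: nbhs_infty_ge.
Unshelve. all: by end_near. Qed.

Lemma cauchy_seq_cvg (X : completeNormedModType K) (u : nat -> X) :
  (forall e : K, 0 < e -> exists N, forall n, (N <= n)%N -> `|u N - u n| <= e) ->
  exists l : X, u @ \oo --> l.
Proof.
move=> uC; suff /cauchy_cvg/(cvgP _) : cauchy (fmap u (nbhs \oo)) by exists (lim (u @ \oo)).
apply: cauchy_exP => e e0.
have [N uN] := uC (e / 2%:R) (divr_gt0 e0 (ltr0n _ 2)).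
exists (u N); rewrite -ball_normE /=.
suff : \forall n \near \oo, `|u N - u n| < e by [].
near=> n.
apply: (le_lt_trans (uN _ _)); first by near: n; exact: nbhs_infty_ge.
by rewrite ltr_pdivrMr// ltr_pMr// ltr1n.
Unshelve. all: by end_near. Qed.

Lemma cvg_dist_le (X : normedModType K) (I : Type) (F : set_system I)
    (u : I -> X) (a l : X) (c : K) :
  ProperFilter F -> u @ F --> l -> (\forall n \near F, `|u n - a| <= c) ->
  `|l - a| <= c.
Proof.
move=> FF ul uc; apply/ler_addgt0Pr => e e0.
have : \forall n \near F, `|l - u n| <= e by apply: cvgr_dist_le.
move=> /(filterI uc)/filter_ex[n [nc ne]].
by rewrite -(subrKA (u n)) (le_trans (ler_normD _ _))// [leRHS]addrC lerD.
Qed.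

End Sequences.

Section BoundedMaps.
Variable K : numFieldType.

Definition bounded_by (X Y : normedModType K) (f : X -> Y) (c : K) :=
  forall x, `|f x| <= c * `|x|.

Lemma bounded_byW (X Y : normedModType K) (f : X -> Y) c d :
  c <= d -> bounded_by f c -> bounded_by f d.
Proof. by move=> cd fc x; rewrite (le_trans (fc x))// ler_wpM2r. Qed.

Lemma continuous_bounded_by (X Y : normedModType K) (f : {linear X -> Y}) :
  continuous f -> exists2 c : K, 0 <= c & bounded_by f c.
Proof.
move=> /linear_bounded_continuous/linear_boundedP fb.
have : \forall r \near +oo, 0 <= r /\ bounded_by f r.
  by apply: filterI fb; exact: nbhs_pinfty_ge.
move=> /pinfty_ex_gt0[r r0 [_ fr]]; exists r => //; exact: ltW.
Qed.

End BoundedMaps.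

Section UniformBoundedness.
Variables (R : realType) (k : scalar_kind).
Local Notation K := (scalars R k).

(** If no uniform bound exists, every ball contains a smaller closed ball on which
some [f i] is at least [n] in norm: add to the centre a vector of the ball that
[f i] stretches more than it can stretch the centre, whose image is bounded
uniformly in [i]. Nesting such balls for n = 0, 1, ... leads to a point at which
the family is not bounded. *)
Lemma uniform_boundedness (X : completeNormedModType K) (Y : normedModType K)
    (I : Type) (f : I -> X -> Y) :
  (forall i, linear (f i)) ->
  (forall i, exists2 c : K, 0 <= c & bounded_by (f i) c) ->
  (forall x, exists2 c : K, 0 <= c & forall i, `|f i x| <= c) ->
  exists2 M : K, 0 <= M & forall i, bounded_by (f i) M.
Proof.
move=> flin fbd fpt; apply: contrapT => unb.
have fB i : {morph f i : x y / x - y}.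
  by move=> x y; rewrite addrC -scaleN1r flin scaleN1r addrC.
have f0 i : f i 0 = 0 by rewrite -{1}(subrr 0) fB subrr.
have fN i x : f i (- x) = - f i x by rewrite -[- x]sub0r fB f0 sub0r.
have fZ i a x : f i (a *: x) = a *: f i x.
  by rewrite -[a *: x]addr0 flin f0 addr0.
have large M : 0 <= M -> exists i x, M * `|x| <= `|f i x| /\ x != 0.
  move=> M0; apply: contrapT => small; apply: unb; exists M => // i x.
  have [->|x0] := eqVneq x 0; first by rewrite f0 !normr0 mulr0.
  have [//|/ltW Mx] := real_leP (normr_real (f i x)) (ger0_real (mulr_ge0 M0 (normr_ge0 x))).
  by case: small; exists i, x.
(* [a] consists of the level n and of the centre and radius of the given ball;
   [q] is the centre and radius of the new one. *)
have step (a : nat * (X * K)) : exists q : X * K, 0 < a.2.2 ->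
    [/\ 0 < q.2, q.2 <= a.2.2 / 2%:R, `|q.1 - a.2.1| <= a.2.2 / 2%:R &
      forall y, `|y - q.1| <= q.2 -> exists i, a.1%:R <= `|f i y|].
  case: a => n [x r] /=.
  have [r0|nr0] := boolP (0 < r); last by exists (x, r).
  have r20 : 0 < r / 2%:R by rewrite divr_gt0.
  have [c c0 xc] := fpt x.
  have M0 : 0 <= (n.+1%:R + c) / (r / 2%:R) by rewrite divr_ge0 ?addr_ge0// ltW.
  have [i [w [wM w0]]] := large _ M0.
  have nw0 : 0 < `|w| by rewrite normr_gt0.
  have [b b0 fb] := fbd i.
  set s := r / 2%:R.
  have sw0 : 0 <= s / `|w| by rewrite divr_ge0// ltW.
  have bs0 : 0 < 1 + b * s by rewrite ltr_pwDl// mulr_ge0// ltW.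
  (* The radius is at most s and at most 1 / b, so that [f i] varies by at most 1
     on the new ball. *)
  exists (x + (s / `|w|) *: w, s / (1 + b * s)) => _ /=; split.
  - by rewrite divr_gt0.
  - by rewrite ler_pdivrMr// ler_pMr// lerDl mulr_ge0// ltW.
  - by rewrite addrC addKr normrZ (ger0_norm sw0) -mulrA mulVf ?mulr1// gt_eqF.
  move=> y yd; exists i.
  have fw : n.+1%:R + c <= `|f i ((s / `|w|) *: w)|.
    rewrite fZ normrZ (ger0_norm sw0) mulrAC ler_pdivlMr// (mulrC s).
    by rewrite -ler_pdivrMr// mulrAC.
  have by1 : `|f i (y - (x + (s / `|w|) *: w))| <= 1.
    rewrite (le_trans (fb _))// (le_trans (ler_wpM2l b0 yd))// mulrA ler_pdivrMr// mul1r.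
    by rewrite lerDr.
  have : n.+1%:R + c <= 1 + `|f i y| + c.
    rewrite (le_trans fw)//.
    have -> : (s / `|w|) *: w = y - (y - (x + (s / `|w|) *: w)) - x.
      by rewrite subKr addrC addKr.
    rewrite fB (le_trans (ler_normB _ _))// lerD// fB [leRHS]addrC.
    by rewrite (le_trans (ler_normB _ _))// lerD2l.
  by rewrite lerD2r -natr1 addrC lerD2l.
have [g gP] := choice step.
pose p := fix p n : X * K := if n is m.+1 then g (m, p m) else (0, 1).
have p0 n : 0 < (p n).2 by elim: n => [|n IH]//=; case: (gP (n, p n) IH).
have ps n := gP (n, p n) (p0 n).
have pn n : (p n).2 <= 1 / 2%:R ^+ n.
  elim: n => [|n IH]; first by rewrite /= divr1.
  case: (ps n) => _ /le_trans + _ _; apply.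
  by rewrite exprSr invfM mulrA ler_pM2r.
have pd n m : `|(p (n + m)%N).1 - (p n).1| <= (p n).2 - (p (n + m)%N).2.
  elim: m => [|m IH]; first by rewrite addn0 !subrr normr0.
  rewrite addnS; case: (ps (n + m)%N) => _ h1 h2 _.
  rewrite -(subrKA (p (n + m)%N).1) (le_trans (ler_normD _ _))//.
  rewrite [leRHS](_ : _ = ((p (n + m)%N).2 - (p (n + m).+1).2) +
      ((p n).2 - (p (n + m)%N).2)); last first.
    by rewrite [RHS]addrC subrKA.
  rewrite lerD// (le_trans h2)// lerBrDr (le_trans (lerD (lexx _) h1))//.
  by rewrite -splitr.
have [|l pl] := @cauchy_seq_cvg R k X (fun n => (p n).1).
  move=> e e0.
  have /(_ _ (@small_times_le R k e e0)) := @cvg_halves R k 1 ler01.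
  move=> [N _ /(_ N (leqnn N)) /= Ne]; exists N => n Nn.
  rewrite distrC -(subnKC Nn) (le_trans (pd _ _))// (le_trans _ Ne)// (le_trans _ (pn N))//.
  by rewrite gerBl ltW.
have [c c0 lc] := fpt l.
have [n cn] := scalars_archi (addr_ge0 c0 ler01).
have [_ _ _] := ps n; case/(_ l) => [|i].
  apply: (@cvg_dist_le R k X nat _ _ _ _ _ _ pl).
  exists n.+1 => // m /= nm; rewrite -(subnKC nm) (le_trans (pd _ _))//.
  by rewrite gerBl ltW.
move=> /(le_trans cn)/le_trans/(_ (lc i)).
by rewrite gerDl lt_geF.
Qed.

End UniformBoundedness.

(** * The mean value inequality for semigroups *)

Lemma telescope3 (V : zmodType) (a b c d e w : V) :
  a - w - (e + d) = (a - b - c) + (c - d) + (b - w - e).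
Proof.
rewrite subrKA (addrC e) opprD addrA.
by rewrite [RHS](AC (3*3) ((1*5*3*6)*(2*4))) /= addNr addr0.
Qed.

Section LinearMaps.
Variables (K : numFieldType) (U V : lmodType K) (f : {linear U -> V}).
Lemma linB u v : f (u - v) = f u - f v. Proof. exact: raddfB. Qed.
Lemma linD u v : f (u + v) = f u + f v. Proof. exact: raddfD. Qed.
Lemma linZ a u : f (a *: u) = a *: f u. Proof. exact: linearZ. Qed.
End LinearMaps.

Section Semigroup.
Variables (R : realType) (k : scalar_kind).
Local Notation K := (scalars R k).
Variables (X : completeNormedModType K) (T : K -> {linear X -> X}).
Hypothesis T_sg : C0_semigroup T.

Lemma semigroup0 x : T 0 x = x.
Proof. by case: T_sg. Qed.

Lemma semigroupD s t x : 0 <= s -> 0 <= t -> T (s + t) x = T s (T t x).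
Proof. by case: T_sg => _ _ TD _; exact: TD. Qed.

Lemma semigroupC s t x : 0 <= s -> 0 <= t -> T s (T t x) = T t (T s x).
Proof. by move=> s0 t0; rewrite -!semigroupD// addrC. Qed.

Lemma semigroup_iter n h x : 0 <= h -> iter n (T h) x = T (n%:R * h) x.
Proof.
move=> h0; elim: n => [|n IH] /=; first by rewrite mul0r semigroup0.
by rewrite IH -semigroupD ?mulr_ge0// -[in RHS]natr1 mulrDl mul1r addrC.
Qed.

Lemma semigroup_orbit_cvg x (s : K) : 0 <= s ->
  (fun t => T t x) @ within [set t : K | 0 <= t] (nbhs s) --> T s x.
Proof.
by move=> s0; case: T_sg => _ _ _ /(_ x)/subspace_continuousP; exact.
Qed.

Lemma semigroup_near0 x (e : K) : 0 < e ->
  \forall q \near @small_times R k, `|T q x - x| <= e.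
Proof.
move=> e0; have := @semigroup_orbit_cvg x 0 (lexx 0).
rewrite semigroup0 => /cvgr_dist_le/(_ e e0); apply: filterS => q.
by rewrite distrC.
Qed.

(** Orbits are bounded on the compact segment [0, t]; uniform boundedness makes
the bound independent of the orbit. *)
Lemma semigroup_locally_bounded (t : K) :
  exists2 M : K, 1 <= M & forall s, 0 <= s <= t -> bounded_by (T s) M.
Proof.
pose I := {s : K | 0 <= s <= t}.
have [|[s st]|x|M M0 TM] := @uniform_boundedness R k X X I (fun i => T (sval i)).
- by move=> i a x y; rewrite linearP.
- have /andP[s0 _] := st; apply: continuous_bounded_by.
  by case: T_sg => + _ _ _; exact.
- have cpt := iffLR (compact_near_coveringP _) (@scalars_segment_compact R k t).
  have := cpt nat \oo (fun n s => 0 <= s -> `|T s x| <= n%:R) _.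
  case=> [s /andP[s0 st]|N _ /(_ N (leqnn N)) NP].
  + have [n xn] := scalars_archi (addr_ge0 ler01 (normr_ge0 (T s x))).
    have : \forall s' \near s, 0 <= s' -> `|T s x - T s' x| <= 1.
      by have := @semigroup_orbit_cvg x s s0; move=> /cvgr_dist_le/(_ 1 ltr01).
    move=> s1; exists ([set s' | 0 <= s' -> `|T s x - T s' x| <= 1], [set m | (n <= m)%N]).
      by split=> //; exists n.
    move=> [s' m] /= [s'P nm] s'0.
    rewrite -(subKr (T s x) (T s' x)) (le_trans (ler_normB _ _))//.
    rewrite addrC (le_trans (lerD (s'P s'0) (lexx _)))// (le_trans xn)// ler_nat//.
  + exists N%:R; first exact: ler0n.
    by move=> [s st] /=; apply: NP => //; case/andP: st.
exists (1 + M); first by rewrite lerDl.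
move=> s st; apply: (@bounded_byW _ _ _ _ M); last exact: (TM (exist _ s st)).
by rewrite lerDr ler01.
Qed.

(** T(nh)w - w is a sum of n increments T(jh)(T(h)w - w), each of which is
h T(jh)v up to an error eps h, and T(jh)v is within [c] of [v]. *)
Lemma semigroup_increment_step w v (h M eps c : K) n : 0 <= h -> 0 <= M ->
  (forall s, 0 <= s <= n%:R * h -> bounded_by (T s) M) ->
  (forall s, 0 <= s <= n%:R * h -> `|T s v - v| <= c) ->
  `|T h w - w - h *: v| <= eps * h ->
  `|T (n%:R * h) w - w - (n%:R * h) *: v| <= (n%:R * h) * (M * eps + c).
Proof.
move=> h0 M0; elim: n => [|n IH] TM vc wh.
  by rewrite !mul0r semigroup0 subrr sub0r scale0r oppr0 normr0.
have nS : n%:R * h <= n.+1%:R * h by rewrite ler_wpM2r// ler_nat.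
have nh0 : 0 <= n%:R * h by rewrite mulr_ge0.
have {}IH : `|T (n%:R * h) w - w - (n%:R * h) *: v| <= (n%:R * h) * (M * eps + c).
  apply: IH => // s /andP[s0 sn]; [apply: TM|apply: vc];
  by rewrite s0 (le_trans sn).
have nhP : 0 <= n%:R * h <= n.+1%:R * h by rewrite nh0.
have -> : T (n.+1%:R * h) w - w - (n.+1%:R * h) *: v =
    T (n%:R * h) (T h w - w - h *: v) + h *: (T (n%:R * h) v - v) +
    (T (n%:R * h) w - w - (n%:R * h) *: v).
  rewrite -natr1 mulrDl mul1r semigroupD// scalerDl.
  rewrite !(linB (T (n%:R * h))) (linZ (T (n%:R * h))) scalerBr.
  exact: telescope3.
rewrite -[in leRHS]natr1 mulrDl mul1r [in leRHS]mulrDl [leRHS]addrC.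
rewrite (le_trans (ler_normD _ _))// lerD// (le_trans (ler_normD _ _))//.
rewrite mulrDr lerD//.
  rewrite (le_trans (TM _ nhP _))// mulrCA ler_wpM2l//.
  by rewrite (le_trans wh)// mulrC.
by rewrite normrZ ger0_norm// ler_wpM2l// vc.
Qed.

(** Mean value inequality. The derivative [v] of the orbit of [w] at 0 is only
required along some arbitrarily small steps [h]: the multiples of such a step
that lie below [r] come within [h] of [r]. This weak form is what identifies
limits of dyadic means as elements of the domain. *)
Lemma semigroup_increment w v (r c : K) : 0 <= r ->
  (forall e d : K, 0 < e -> 0 < d ->
     exists h, [/\ 0 < h, h <= d & `|T h w - w - h *: v| <= e * h]) ->
  (forall q, 0 <= q <= r -> `|T q v - v| <= c) ->
  `|T r w - w - r *: v| <= r * c.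
Proof.
move=> r0 wv vc.
have [M M1 TM] := semigroup_locally_bounded r.
have M0 : 0 < M by rewrite (lt_le_trans ltr01).
apply/ler_addgt0Pr => e e0.
have r1 : 0 < 1 + r by rewrite ltr_pwDl.
have v1 : 0 < 1 + `|v| by rewrite ltr_pwDl.
have e3 : 0 < e / 3%:R by rewrite divr_gt0.
have [d d0 dP] := small_timesP (semigroup_near0 w (divr_gt0 e3 M0)).
have [d' d'0 d'P] := small_timesP (filterI (small_times_le d0)
  (small_times_le (divr_gt0 e3 v1))).
have [||h [h0 hd wh]] := wv (e / 3%:R / (M * (1 + r))) d' => //.
  by rewrite divr_gt0// mulr_gt0.
have [hd1 hd2] := d'P h (ltW h0) hd.
have [m /andP[mr rm]] := scalars_floor r0 h0.
have mh0 : 0 <= m%:R * h by rewrite mulr_ge0// ltW.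
have inc := @semigroup_increment_step w v h M _ c m (ltW h0) (ltW M0) _ _ wh.
set q := r - m%:R * h.
have q0 : 0 <= q by rewrite subr_ge0.
have qh : q <= h by rewrite lerBlDl.
have rE : r = m%:R * h + q by rewrite addrC subrK.
have -> : T r w - w - r *: v = T (m%:R * h) (T q w - w) - q *: v +
   (T (m%:R * h) w - w - (m%:R * h) *: v).
  rewrite {1 2}rE semigroupD// (linB (T _)) scalerDl opprD.
  by rewrite [RHS](AC (3*3) ((1*5*3*6)*(2*4))) /= addNr addr0 (addrC (- _)) addrA.
(* Split at the last multiple m h of the step; the rest q = r - m h is short. *)
have -> : r * c + e = e / 3%:R + e / 3%:R + (r * c + e / 3%:R).
  by rewrite {1}(third_sum e) addrCA.
rewrite (le_trans (ler_normD _ _))// lerD//.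
  rewrite (le_trans (ler_normB _ _))// lerD//.
    have mhP : 0 <= m%:R * h <= r by rewrite mh0.
    rewrite (le_trans (TM _ mhP _))// mulrC -ler_pdivlMr//.
    by apply: dP => //; exact: le_trans hd1.
  rewrite normrZ ger0_norm//.
  have : q <= e / 3%:R / (1 + `|v|) by rewrite (le_trans qh).
  rewrite ler_pdivlMr//; apply: le_trans; rewrite ler_wpM2l//.
  by rewrite lerDr.
have c0 : 0 <= c by rewrite (le_trans _ (vc 0 _))// lexx.
apply: (le_trans (inc _ _)).
- by move=> s /andP[s0 sm]; apply: TM; rewrite s0 (le_trans sm).
- by move=> s /andP[s0 sm]; apply: vc; rewrite s0 (le_trans sm).
rewrite mulrDr addrC lerD ?ler_wpM2r//.
rewrite (_ : M * _ = e / 3%:R / (1 + r)); last first.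
  by rewrite mulrCA invfM mulVKf ?gt_eqF.
rewrite mulrCA -[leRHS]mulr1 ler_wpM2l ?(ltW e3)// ler_pdivrMr// mul1r.
by rewrite (le_trans mr)// lerDr.
Qed.

End Semigroup.

(** * Generators *)

Section OrbitUniform.
Variables (R : realType) (k : scalar_kind).
Local Notation K := (scalars R k).
Variables (X : completeNormedModType K) (T : K -> {linear X -> X}).
Hypothesis T_sg : C0_semigroup T.

(** Strong continuity at 0 is uniform on compact sets, here on the range of a
continuous curve over [0, t], because T is locally bounded. *)
Lemma semigroup_near0_uniform (t : K) (y : K -> X) :
  (forall s, 0 <= s <= t -> y @ within [set s : K | 0 <= s] (nbhs s) --> y s) ->
  forall e : K, 0 < e -> \forall q \near @small_times R k,
    forall s, 0 <= s <= t -> `|T q (y s) - y s| <= e.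
Proof.
move=> yc e e0.
have [M M1 TM] := semigroup_locally_bounded T_sg 1.
have M0 : 0 < M by rewrite (lt_le_trans ltr01).
have e3 : 0 < e / 3%:R by rewrite divr_gt0.
have cpt := iffLR (compact_near_coveringP _) (@scalars_segment_compact R k t).
have cptP := cpt K (@small_times R k) (fun q s => 0 <= s -> `|T q (y s) - y s| <= e)
  (@small_times_filter R k).
apply: filterS (cptP _).
  by move=> q qP s sP; apply: qP => //; case/andP: sP.
move=> s /= sP.
have /andP[s0 st] := sP.
have eM : 0 < e / 3%:R / M by rewrite divr_gt0.
have ys : \forall s' \near s, 0 <= s' -> `|y s - y s'| <= e / 3%:R / M.
  by have := yc s sP; move=> /cvgr_dist_le/(_ _ eM).
have near1 : \forall q \near @small_times R k, 0 <= q <= 1 /\ `|T q (y s) - y s| <= e / 3%:R.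
  have := semigroup_near0 T_sg (y s) e3.
  have := @small_times_le R k _ ltr01; apply: filterS3 (@small_times_ge0 R k).
  by move=> q -> ->.
exists ([set s' | 0 <= s' -> `|y s - y s'| <= e / 3%:R / M],
   [set q | 0 <= q <= 1 /\ `|T q (y s) - y s| <= e / 3%:R]) => //.
move=> [s' q] /= [s'P [qP qs]] s'0.
have {s'P} ss' := s'P s'0.
have -> : T q (y s') - y s' =
    (T q (y s') - T q (y s)) + (T q (y s) - y s) + (y s - y s').
  by rewrite !subrKA.
rewrite (third_sum e) (le_trans (ler_normD _ _))// lerD//.
  rewrite (le_trans (ler_normD _ _))// lerD//.
  rewrite -linB (le_trans (TM _ qP _))// mulrC -ler_pdivlMr// distrC//.
rewrite (le_trans ss')// ler_pdivrMr// ler_peMr// ltW//.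
Qed.

End OrbitUniform.

Section Generator.
Variables (R : realType) (k : scalar_kind).
Local Notation K := (scalars R k).
Variables (X : completeNormedModType K) (A : operator X X) (T : K -> {linear X -> X}).
Hypothesis gen : generates A T.

Let T_sg : C0_semigroup T. Proof. by case: gen. Qed.

Lemma generator_increment w (r c : K) : dom A w -> 0 <= r ->
  (forall q, 0 <= q <= r -> `|T q (A w) - A w| <= c) ->
  `|T r w - w - r *: A w| <= r * c.
Proof.
move=> wA r0; apply: semigroup_increment => // e d e0 d0.
have /(proj2 gen)/cvgr_dist_le/(_ e e0) wv : dom A w /\ A w = A w by [].
have /filter_ex[h [h0 hd hv]] : \forall h \near (0 : K)^'+,
    [/\ 0 < h, h <= d & `|A w - h^-1 *: (T h w - w)| <= e].
  near=> h; split; near: h => //; first exact: nbhs_right_gt.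
  exact/near_right_small_times/small_times_le.
exists h; split=> //.
have -> : T h w - w - h *: A w = - (h *: (A w - h^-1 *: (T h w - w))).
  by rewrite scalerBr scalerA mulfV ?gt_eqF// scale1r opprB.
by rewrite normrN normrZ gtr0_norm// mulrC ler_pM2r.
Unshelve. all: by end_near. Qed.

(** By the mean value inequality a derivative along some small steps is a
derivative. *)
Lemma generator_intro w v :
  (forall e d : K, 0 < e -> 0 < d ->
     exists h, [/\ 0 < h, h <= d & `|T h w - w - h *: v| <= e * h]) ->
  dom A w /\ A w = v.
Proof.
move=> wv; apply/(proj2 gen)/cvgrPdist_le => e e0.
have := small_times_down (semigroup_near0 T_sg v e0).
move=> /near_right_small_times; apply: filter_app.
have := nbhs_right_gt (0 : K); apply: filter_app; near=> h => h0 hv.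
have := semigroup_increment T_sg (ltW h0) wv hv.
have -> : v - h^-1 *: (T h w - w) = - (h^-1 *: (T h w - w - h *: v)).
  by rewrite [h^-1 *: (_ - h *: v)]scalerBr scalerA mulVf ?gt_eqF// scale1r opprB.
by rewrite normrN normrZ gtr0_norm ?invr_gt0// ler_pdivrMl.
Unshelve. all: by end_near. Qed.

(** The mean value inequality with v = 0 and c = 0. *)
Lemma generator_kernel w t : dom A w -> A w = 0 -> 0 <= t -> T t w = w.
Proof.
move=> wA Aw0 t0; have := @generator_increment w t 0 wA t0.
rewrite Aw0 scaler0 subr0 mulr0 normr_le0 subr_eq0 => H; apply/eqP/H => q _.
by rewrite -[X in T q X](subrr 0) linB !subrr normr0.
Qed.

Lemma generator_invariant w s : 0 <= s -> dom A w ->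
  dom A (T s w) /\ A (T s w) = T s (A w).
Proof.
move=> s0 wA; apply/(proj2 gen).
have /(proj2 gen) wv : dom A w /\ A w = A w by [].
have Tc : continuous (T s) by case: T_sg => + _ _ _; exact.
have := cvg_comp _ _ wv (Tc (A w)).
apply: cvg_trans; apply: near_eq_cvg; near=> h => /=.
by rewrite linZ linB semigroupC.
Unshelve. all: by end_near. Qed.

(** By the mean value inequality the error at g(s) is at most h times the
oscillation of T(q) A g(s) over q in [0, h], which is uniformly small because
A g has compact range. *)
Lemma generator_increment_uniform (t : K) (g : K -> X) :
  (forall s, 0 <= s <= t -> dom A (g s)) ->
  (forall s, 0 <= s <= t ->
    (A \o g) @ within [set s : K | 0 <= s] (nbhs s) --> A (g s)) ->
  forall e : K, 0 < e -> \forall h \near @small_times R k,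
    forall s, 0 <= s <= t -> `|T h (g s) - g s - h *: A (g s)| <= h * e.
Proof.
move=> gA Agc e e0.
have := small_times_down (semigroup_near0_uniform T_sg Agc e0).
have := @small_times_ge0 R k; apply: filterS2 => h h0 hP s st.
by apply: generator_increment => [||q qh] //; [exact: gA|exact: hP].
Qed.

Lemma generator_orbit_cvg (x : X) (s : K) : dom A x -> 0 <= s ->
  (fun s => A (T s x)) @ within [set s : K | 0 <= s] (nbhs s) --> A (T s x).
Proof.
move=> xA s0; rewrite (proj2 (generator_invariant s0 xA)).
have := semigroup_orbit_cvg T_sg s0 (x := A x).
apply: cvg_trans; apply: near_eq_cvg; rewrite near_withinE; near=> q => q0.
by rewrite (proj2 (generator_invariant q0 xA)).
Unshelve. all: by end_near. Qed.

End Generator.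

Section Density.
Variables (R : realType) (k : scalar_kind).
Local Notation K := (scalars R k).
Variables (X : completeNormedModType K) (A : operator X X) (T : K -> {linear X -> X}).
Hypothesis gen : generates A T.

Let T_sg : C0_semigroup T. Proof. by case: gen. Qed.

(** The mean of T(j h / 2^m) x over 0 <= j < 2^m, a Riemann sum of the average of
the orbit of x over [0, h]. The recursive form is the factorization of the sum
into the factors (1 + T(h / 2^i)) / 2, so no double sum has to be reindexed. *)
Fixpoint dyadic_mean (m : nat) (h : K) (x : X) : X :=
  if m is n.+1 then
    2%:R^-1 *: (dyadic_mean n (h / 2%:R) x + dyadic_mean n (h / 2%:R) (T (h / 2%:R) x))
  else x.

Lemma dyadic_mean_near m (h c : K) x a : 0 <= h ->
  (forall r, 0 <= r <= h -> `|T r x - a| <= c) -> `|dyadic_mean m h x - a| <= c.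
Proof.
elim: m h x => [|m IH] h x h0 xa /=.
  by rewrite -{1}(semigroup0 T_sg x) xa// lexx.
have h20 : 0 <= h / 2%:R by rewrite divr_ge0.
have -> : forall u v : X, 2%:R^-1 *: (u + v) - a = 2%:R^-1 *: ((u - a) + (v - a)).
  move=> u v; rewrite addrACA -opprD scalerBr; congr (_ - _).
  by rewrite scalerDr -scalerDl -[X in X + X]mul1r half_halves scale1r.
rewrite normrZ gtr0_norm ?invr_gt0// ler_pdivrMl// mulr_natl mulr2n.
have hh : h / 2%:R <= h by rewrite -[leRHS]half_halves lerDl.
rewrite (le_trans (ler_normD _ _))// lerD// IH// => r /andP[r0 rh].
  by rewrite xa// r0 (le_trans rh).
rewrite -semigroupD// xa// addr_ge0//= -[leRHS]half_halves lerD//.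
Qed.

Lemma dyadic_mean_lin m (h a : K) x y : 
  dyadic_mean m h (a *: x + y) = a *: dyadic_mean m h x + dyadic_mean m h y.
Proof.
elim: m h x y => [//|m IH] h x y /=.
rewrite (linearP (T _)) !IH addrACA -[in LHS]scalerDr [LHS]scalerDr !scalerA.
by rewrite [in LHS]mulrC.
Qed.

Lemma dyadic_meanB m (h : K) x y : 
  dyadic_mean m h (x - y) = dyadic_mean m h x - dyadic_mean m h y.
Proof. by rewrite addrC -scaleN1r dyadic_mean_lin scaleN1r addrC. Qed.

Lemma dyadic_mean_comm m (h s : K) x : 0 <= h -> 0 <= s ->
  T s (dyadic_mean m h x) = dyadic_mean m h (T s x).
Proof.
elim: m h x => [//|m IH] h x h0 s0 /=.
have h20 : 0 <= h / 2%:R by rewrite divr_ge0.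
by rewrite linZ linD !IH// semigroupC.
Qed.

(** A finer mean is a coarse mean of fine means over one short step; this
makes the sequence of means Cauchy. *)
Lemma dyadic_mean_add m n (h : K) x : 0 <= h ->
  dyadic_mean (m + n) h x = dyadic_mean m h (dyadic_mean n (h / 2%:R ^+ m) x).
Proof.
elim: m h x => [|m IH] h x h0 /=; first by rewrite expr0 divr1.
have h20 : 0 <= h / 2%:R by rewrite divr_ge0.
rewrite !IH// !exprS invfM mulrA dyadic_mean_comm//.
by rewrite divr_ge0// exprn_ge0.
Qed.

(** The sum over j telescopes. *)
Lemma dyadic_mean_increment m (h : K) x : 0 <= h ->
  T (h / 2%:R ^+ m) (dyadic_mean m h x) - dyadic_mean m h x =
  (2%:R ^- m) *: (T h x - x).
Proof.
elim: m h x => [|m IH] h x h0 /=; first by rewrite expr0 divr1 invr1 scale1r.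
have h20 : 0 <= h / 2%:R by rewrite divr_ge0.
rewrite linZ linD -scalerBr opprD addrACA.
have -> : h / 2%:R ^+ m.+1 = h / 2%:R / 2%:R ^+ m by rewrite exprS invfM mulrA.
rewrite !IH// -scalerDr scalerA -invfM -exprS; congr (_ *: _).
by rewrite addrC subrKA -semigroupD// half_halves.
Qed.

(** The limit [y] of the dyadic means over [0, a] stands for the average of the
orbit of [x]. It is close to [x] for small [a], and by telescoping its orbit has
the derivative (T(a)x - x) / a along the steps a / 2^m, which suffices. *)
Lemma generator_dense (x : X) (e : K) : 0 < e -> exists2 y, dom A y & `|x - y| <= e.
Proof.
move=> e0.
have /small_timesP[a a0 aP] := small_times_down (semigroup_near0 T_sg x e0).
have {aP} aP := aP a (ltW a0) (lexx a).
have [M M1 TM] := semigroup_locally_bounded T_sg a.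
have M0 : 0 < M by rewrite (lt_le_trans ltr01).
have Dbound m z : `|dyadic_mean m a z| <= M * `|z|.
  rewrite -[X in `|X|]subr0; apply: dyadic_mean_near; first exact: ltW.
  by move=> r ra; rewrite subr0 TM.
have am0 m : 0 < a / 2%:R ^+ m by rewrite divr_gt0// exprn_gt0.
pose u m := dyadic_mean m a x.
have osc d : 0 < d ->
    \forall m \near \oo, forall r, 0 <= r <= a / 2%:R ^+ m -> `|T r x - x| <= d.
  by move=> d0; have := cvg_halves (ltW a0) (small_times_down (semigroup_near0 T_sg x d0)).
have [y uy] : exists y : X, u @ \oo --> y.
  apply: cauchy_seq_cvg => d d0.
  have [N _ /(_ N (leqnn N)) NP] := osc _ (divr_gt0 d0 M0).
  exists N => n Nn; rewrite /u -(subnKC Nn) (dyadic_mean_add _ _ _ (ltW a0)).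
  rewrite -dyadic_meanB (le_trans (Dbound _ _))// mulrC -ler_pdivlMr// distrC.
  by apply: dyadic_mean_near => //; exact: ltW.
exists y; last first.
  rewrite distrC; apply: (@cvg_dist_le R k X nat \oo u _ _ _ _ uy); apply: nearW => n.
  by apply: dyadic_mean_near => //; exact: ltW.
suff [] : dom A y /\ A y = a^-1 *: (T a x - x) by [].
apply: (generator_intro gen) => d d' d0 d'0.
have Ma0 : 0 < (M + 1) / a by rewrite divr_gt0// addr_gt0.
have small : \forall m \near \oo, a / 2%:R ^+ m <= d'.
  by have := cvg_halves (ltW a0) (small_times_le d'0).
have [m [md' mP]] : exists m, a / 2%:R ^+ m <= d' /\
    forall r, 0 <= r <= a / 2%:R ^+ m -> `|T r x - x| <= d / ((M + 1) / a).
  by apply: (@filter_ex _ \oo _ _ _); apply: filterI small (osc _ (divr_gt0 d0 Ma0)).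
set h := a / 2%:R ^+ m; exists h; split=> //; first exact: am0.
have Tc : continuous (fun z => T h z - z).
  move=> z; apply: cvgB; last exact: cvg_id.
  by case: T_sg => + _ _ _; apply; exact/ltW/am0.
have ucv : (fun n => T h (u n) - u n) @ \oo --> T h y - y := cvg_comp _ _ uy (Tc y).
apply: (@cvg_dist_le R k X nat \oo (fun n => T h (u n) - u n) _ _ _ _ ucv).
exists m => // n /= mn; rewrite /u -(subnKC mn) (dyadic_mean_add _ _ _ (ltW a0)).
rewrite (dyadic_mean_increment _ _ (ltW a0)).
have -> : h *: (a^-1 *: (T a x - x)) = 2%:R ^- m *: (T a x - x).
  by rewrite scalerA mulrAC mulfV ?gt_eqF// mul1r.
set z := dyadic_mean _ _ x.
have zx : `|z - x| <= d / ((M + 1) / a) by apply: dyadic_mean_near => //; exact: ltW.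
rewrite -scalerBr normrZ ger0_norm ?invr_ge0 ?exprn_ge0//.
have -> : T a z - z - (T a x - x) = T a (z - x) - (z - x).
  by rewrite (linB (T a)) !opprB [LHS]addrACA [RHS]addrACA (addrC (- z)).
have -> : d * h = 2%:R ^- m * ((M + 1) * (d / ((M + 1) / a))).
  rewrite invf_div [X in _ = _ * X]mulrC -!mulrA mulVf ?mulr1 ?gt_eqF ?addr_gt0//.
  by rewrite /h [LHS]mulrA [LHS]mulrC.
rewrite ler_wpM2l ?invr_ge0 ?exprn_ge0// (le_trans (ler_normB _ _))// mulrDl mul1r lerD//.
by rewrite (le_trans (TM _ _ _)) ?ler_wpM2l ?(ltW M0)// lexx ltW.
Qed.

End Density.

(** * Telescoping and its first application *)

Lemma mul5_shuffle (F : comPzRingType) (n M h e c : F) :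
  n * (M * (h * (e * c))) = e * (n * h * (M * c)).
Proof. by ring. Qed.

Lemma mul5_shuffle_div (F : comPzRingType) (n C h e d : F) :
  n * (C * (h * (e * d))) = e * (n * h * C) * d.
Proof. by ring. Qed.

Lemma four_shares (F : comPzRingType) (h e M : F) :
  h * (e * (M + 3%:R)) = M * (h * e) + h * e + h * e + h * e.
Proof. by ring. Qed.

Lemma sub_sub_common (V : zmodType) (a b c : V) : a - c = (a - b) - (c - b).
Proof. by rewrite opprB addrA subrK. Qed.

Section Telescoping.
Variable K : numFieldType.

(** V^n u_0 - u_n is the sum of the V^(n-1-j) (V u_j - u_(j+1)). *)
Lemma iter_bound_telescope (Y : normedModType K) (V : Y -> Y) (u : nat -> Y)
    (n : nat) (M eta : K) :
  {morph V : x y / x - y} -> 0 <= M ->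
  (forall j, (j <= n)%N -> bounded_by (iter j V) M) ->
  (forall j, (j < n)%N -> `|V (u j) - u j.+1| <= eta) ->
  `|iter n V (u 0) - u n| <= n%:R * (M * eta).
Proof.
move=> VB M0; elim: n u => [|n IH] u VM Vu; first by rewrite subrr normr0 mul0r.
have iterB j x y : iter j V (x - y) = iter j V x - iter j V y.
  by elim: j => [//|j IHj] /=; rewrite IHj VB.
have := IH (u \o S) (fun j jn => VM j (leqW jn)) (fun j jn => Vu j.+1 jn).
rewrite /= => {}IH.
rewrite -iterS iterSr -(subrKA (iter n V (u 1))) -iterB.
rewrite (le_trans (ler_normD _ _))// -natr1 mulrDl mul1r [leRHS]addrC lerD//.
by rewrite (le_trans (VM n _ _))// ler_wpM2l// Vu.
Qed.

End Telescoping.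

Section Intertwining.
Variables (R : realType) (k : scalar_kind).
Local Notation K := (scalars R k).
Variables (X Y : completeNormedModType K).
Variables (A : operator X X) (T : K -> {linear X -> X}).
Variables (C : operator Y Y) (U : K -> {linear Y -> Y}).
Variable J : {linear X -> Y}.

(** Uniqueness of the solution of the Cauchy problem for C: along u_j = J T(jh) x
with x in the domain of A, both U(h) and J T(h) follow the derivative J A T(jh) x
up to o(h), so U(h)^n J x - J T(nh) x = n o(h). *)
Lemma generator_intertwine : generates A T -> generates C U -> continuous J ->
  (forall x, dom A x -> dom C (J x) /\ C (J x) = J (A x)) ->
  forall t x, 0 <= t -> U t (J x) = J (T t x).
Proof.
move=> genA genC Jc AC t x t0.
have [c c0 Jb] := continuous_bounded_by Jc.
have [T_sg U_sg] := (proj1 genA, proj1 genC).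
have [N N1 TN] := semigroup_locally_bounded T_sg t.
have [M M1 UM] := semigroup_locally_bounded U_sg t.
have N0 : 0 <= N by rewrite (le_trans ler01).
have M0 : 0 <= M by rewrite (le_trans ler01).
have tt : 0 <= t <= t by rewrite t0 lexx.
have on_dom y : dom A y -> U t (J y) = J (T t y).
  move=> yA; apply/eqP; rewrite -subr_eq0 -normr_le0; apply/ler_addgt0Pr => e e0.
  rewrite add0r.
  have D0 : 0 < 1 + t * (M * (1 + c)) by rewrite ltr_pwDl// !mulr_ge0// addr_ge0.
  have e'0 := divr_gt0 e0 D0; set e' := e / _ in e'0.
  have TyA s : 0 <= s <= t -> dom A (T s y).
    by case/andP=> s0 _; case: (generator_invariant genA s0 yA).
  have Tyc s : 0 <= s <= t ->
      (A \o (fun s => T s y)) @ within [set s : K | 0 <= s] (nbhs s) --> A (T s y).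
    by case/andP=> s0 _; exact: generator_orbit_cvg.
  have JTyc s : 0 <= s <= t ->
      (C \o (fun s => J (T s y))) @ within [set s : K | 0 <= s] (nbhs s) --> C (J (T s y)).
    move=> st; have /andP[s0 _] := st; rewrite (proj2 (AC _ (TyA s st))).
    have := cvg_comp _ _ (Tyc s st) (Jc _).
    apply: cvg_trans; apply: near_eq_cvg; rewrite near_withinE; near=> q => q0 /=.
    by rewrite (proj2 (AC _ _))//; case: (generator_invariant genA q0 yA).
  have inc1 := generator_increment_uniform genA TyA Tyc e'0.
  have inc2 := generator_increment_uniform genC (fun s st => proj1 (AC _ (TyA s st))) JTyc e'0.
  have [n [n0 n1 n2]] : exists n : nat, [/\ (0 < n)%N,
      (forall s, 0 <= s <= t ->
        `|T (t / n%:R) (T s y) - T s y - (t / n%:R) *: A (T s y)| <= (t / n%:R) * e') &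
      (forall s, 0 <= s <= t ->
        `|U (t / n%:R) (J (T s y)) - J (T s y) - (t / n%:R) *: C (J (T s y))| <=
          (t / n%:R) * e')].
    apply: (@filter_ex _ \oo _ _ _).
    apply: filterS3 (nbhs_infty_gt 0) (cvg_step t0 inc1) (cvg_step t0 inc2).
    by move=> n.
  have nK0 : 0 < n%:R :> K by rewrite ltr0n.
  move: n1 n2; set h := t / n%:R => n1 n2.
  have h0 : 0 <= h by rewrite divr_ge0// ltW.
  have nh : n%:R * h = t by rewrite mulrC divfK// gt_eqF.
  have jh j : (j <= n)%N -> 0 <= j%:R * h <= t.
    by move=> jn; rewrite mulr_ge0//= -nh ler_wpM2r// ler_nat.
  have := @iter_bound_telescope K Y (U h) (fun j => J (T (j%:R * h) y)) n M
    (h * (e' * (1 + c))) (@linB _ _ _ _) M0.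
  rewrite mul0r (semigroup0 T_sg) (semigroup_iter U_sg)// nh => telescope.
  apply: le_trans (telescope _ _) _ => [j jn z|j jn|].
  - by rewrite (semigroup_iter U_sg)// UM// jh.
  - have st := jh j (ltnW jn); have /andP[s0 _] := st.
    set s := j%:R * h in st s0 *.
    have -> : j.+1%:R * h = h + s by rewrite -natr1 mulrDl mul1r addrC.
    rewrite (semigroupD T_sg)//.
    have -> : U h (J (T s y)) - J (T h (T s y)) =
       (U h (J (T s y)) - J (T s y) - h *: C (J (T s y))) -
        J (T h (T s y) - T s y - h *: A (T s y)).
      rewrite !(linB J) (linZ J) (proj2 (AC _ (TyA s st))).
      by rewrite opprB addrA subrK opprB addrA subrK.
    rewrite (le_trans (ler_normB _ _))// mulrDr mulr1 mulrDr lerD//; first exact: n2.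
    rewrite (le_trans (Jb _))// mulrA mulrC ler_wpM2r//; exact: n1.
  - have -> : n%:R * (M * (h * (e' * (1 + c)))) = e' * (t * (M * (1 + c))).
      by rewrite -nh; exact: mul5_shuffle.
    by rewrite /e' mulrAC ler_pdivrMr// ler_wpM2l ?(ltW e0)// lerDr.
apply/eqP; rewrite -subr_eq0 -normr_le0; apply/ler_addgt0Pr => e e0.
have D0 : 0 < 1 + (M * c + c * N) by rewrite ltr_pwDl// addr_ge0// !mulr_ge0.
have [y yA xy] := generator_dense genA x (divr_gt0 e0 D0).
have -> : U t (J x) - J (T t x) = U t (J (x - y)) - J (T t (x - y)).
  rewrite !(linB (T t)) !(linB J) (linB (U t)) (on_dom y)//.
  exact: sub_sub_common.
rewrite add0r (le_trans (ler_normB _ _))//.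
rewrite (le_trans (lerD (UM _ tt _) (Jb _)))//.
rewrite (le_trans (lerD (ler_wpM2l M0 (Jb _)) (ler_wpM2l c0 (TN _ tt _))))//.
rewrite !mulrA -mulrDl (le_trans (ler_wpM2l _ xy))//; first by rewrite addr_ge0// !mulr_ge0.
by rewrite mulrA ler_pdivrMr// mulrC ler_wpM2l ?(ltW e0)// lerDr.
Unshelve. all: by end_near. Qed.

End Intertwining.

(** * Operator matrices on the product space *)

Section ProductInjections.
Variables (K : numFieldType) (U V : normedModType K).

Definition inj1 (u : U) : (U * V)%type := (u, 0).
Definition inj2 (v : V) : (U * V)%type := (0, v).

Let inj1_linear : linear inj1.
Proof. by move=> a x y; congr pair; rewrite /= scaler0 addr0. Qed.
Let inj2_linear : linear inj2.
Proof. by move=> a x y; congr pair; rewrite /= scaler0 addr0. Qed.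

HB.instance Definition _ := GRing.isLinear.Build K U (U * V)%type _ inj1 inj1_linear.
HB.instance Definition _ := GRing.isLinear.Build K V (U * V)%type _ inj2 inj2_linear.

Lemma inj1_continuous : continuous inj1.
Proof. by move=> x; apply: cvg_pair; [exact: cvg_id|exact: cvg_cst]. Qed.
Lemma inj2_continuous : continuous inj2.
Proof. by move=> x; apply: cvg_pair; [exact: cvg_cst|exact: cvg_id]. Qed.

Lemma norm_fst_le (z : U * V) : `|z.1| <= `|z|.
Proof.
rewrite prod_normE.
by have [] := real_leP (normr_real z.1) (normr_real z.2).
Qed.
Lemma norm_snd_le (z : U * V) : `|z.2| <= `|z|.
Proof.
rewrite prod_normE.
by have [|/ltW] := real_leP (normr_real z.1) (normr_real z.2).
Qed.
Lemma norm_pair_le (z : U * V) : `|z| <= `|z.1| + `|z.2|.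
Proof.
rewrite prod_normE.
by have [] := real_leP (normr_real z.1) (normr_real z.2); rewrite ?lerDl ?lerDr.
Qed.

End ProductInjections.

(** * Stability of the Lie splitting *)

Section TriangularStability.
Variables (R : realType) (k : scalar_kind).
Local Notation K := (scalars R k).
Variables (E F : completeNormedModType K).
Variables (T : K -> {linear E -> E}) (S : K -> {linear F -> F}).
Hypotheses (T_sg : C0_semigroup T) (S_sg : C0_semigroup S).
Variables (h : K) (Q : F -> E) (V : E * F -> E * F).
Hypotheses (h0 : 0 <= h) (VE : forall z, V z = (T h z.1 + Q z.2, S h z.2)).

Lemma triangular_iter_snd n z : (iter n V z).2 = S (n%:R * h) z.2.
Proof.
rewrite -(semigroup_iter S_sg)//.
by elim: n => [//|n IH]; rewrite !iterS VE IH.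
Qed.

(** The first component of V^n z is T(nh) z.1 plus the sum of the n terms
T((n-1-j)h) Q S(jh) z.2. *)
Lemma triangular_iter_fst n z (M b : K) : 0 <= M ->
  (forall s, 0 <= s <= n%:R * h -> bounded_by (T s) M) ->
  (forall j, (j < n)%N -> `|Q (S (j%:R * h) z.2)| <= b) ->
  `|(iter n V z).1 - T (n%:R * h) z.1| <= n%:R * (M * b).
Proof.
move=> M0; elim: n z => [|n IH] z TM Qb.
  by rewrite !mul0r (semigroup0 T_sg) subrr normr0.
have nh0 : 0 <= n%:R * h by rewrite mulr_ge0.
have nS : n%:R * h <= n.+1%:R * h by rewrite ler_wpM2r// ler_nat.
have {}IH : `|(iter n V (V z)).1 - T (n%:R * h) (V z).1| <= n%:R * (M * b).
  apply: IH => [s /andP[s0 sn]|j jn]; first by apply: TM; rewrite s0 (le_trans sn).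
  rewrite VE/= -(semigroupD S_sg) ?mulr_ge0//.
  by have := Qb j.+1 jn; rewrite -natr1 mulrDl mul1r.
rewrite iterSr.
have -> : T (n.+1%:R * h) z.1 = T (n%:R * h) (V z).1 - T (n%:R * h) (Q z.2).
  by rewrite VE/= linD addrK -(semigroupD T_sg)// -natr1 mulrDl mul1r.
rewrite opprB addrCA addrC (le_trans (ler_normD _ _))// -natr1 mulrDl mul1r lerD//.
have nhP : 0 <= n%:R * h <= n.+1%:R * h by rewrite nh0.
rewrite (le_trans (TM _ nhP _))// ler_wpM2l//.
by have := Qb 0 isT; rewrite mul0r (semigroup0 S_sg).
Qed.

Lemma triangular_stable n (t M N q : K) : 0 <= M -> 0 <= N -> 0 <= q -> n%:R * h <= t ->
  (forall s, 0 <= s <= t -> bounded_by (T s) M) ->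
  (forall s, 0 <= s <= t -> bounded_by (S s) N) ->
  bounded_by Q (q * h) ->
  bounded_by (iter n V) (t * (M * (q * N)) + M + N).
Proof.
move=> M0 N0 q0 nt TM SN Qq z.
have nh0 : 0 <= n%:R * h by rewrite mulr_ge0.
have nhP : 0 <= n%:R * h <= t by rewrite nh0.
rewrite (le_trans (norm_pair_le _))// mulrDl lerD//; last first.
  rewrite triangular_iter_snd (le_trans (SN _ nhP _))//.
  by rewrite ler_wpM2l// norm_snd_le.
rewrite -(subrK (T (n%:R * h) z.1) (iter n V z).1) (le_trans (ler_normD _ _))//.
rewrite mulrDl lerD//; last first.
  by rewrite (le_trans (TM _ nhP _))// ler_wpM2l// norm_fst_le.
have b0 : 0 <= h * (q * (N * `|z|)) by rewrite !mulr_ge0.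
rewrite (le_trans (triangular_iter_fst (b := h * (q * (N * `|z|))) M0 _ _))//.
- by move=> s /andP[s0 sn]; apply: TM; rewrite s0 (le_trans sn).
- move=> j jn; have jP : 0 <= j%:R * h <= t.
    by rewrite mulr_ge0//= (le_trans _ nt)// ler_wpM2r// ler_nat ltnW.
  rewrite (le_trans (Qq _))// mulrAC mulrC ler_wpM2l// ler_wpM2l//.
  by rewrite (le_trans (SN _ jP _))// ler_wpM2l// norm_snd_le.
rewrite (_ : n%:R * _ = n%:R * h * (M * (q * N)) * `|z|).
  by rewrite !ler_wpM2r// !mulr_ge0.
by rewrite -!mulrA; congr (_ * _); rewrite mulrCA.
Qed.

End TriangularStability.

Section OperatorFacts.
Variables (K : numFieldType) (E F : lmodType K) (D : set E) (f : linear_on F D).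
Hypothesis D_sub : Defs.subspace D.

Lemma linear_on0 : f 0 = 0.
Proof.
have [D0 _] := D_sub; have := linear_onP f (-1) D0 D0.
by rewrite scaler0 addr0 scaleN1r addNr.
Qed.

End OperatorFacts.

Section BoundaryFeedback.
Variables (R : realType) (k : scalar_kind).
Local Notation K := (scalars R k).
Variables (E dE : completeNormedModType K).
Variables (Am : operator E E) (B : operator dE dE) (L : linear_on dE (dom Am)).
Variables (T : K -> {linear E -> E}) (S : K -> {linear dE -> dE}).
Variables (T1 T2 : K -> {linear (E * dE)%type -> (E * dE)%type}).
Hypothesis genA : generates (restrict_ker L) T.
Hypothesis surjL : set_surj (dom Am) [set: dE] L.
Hypothesis genB : generates B S.
Hypothesis resA : resolvent_set (restrict_ker L) 0.
Hypothesis favA : dom Am `<=` Fav1 T.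
Hypothesis genA1 : generates (calA1 L) T1.
Hypothesis genA2 : generates (calA2 E B) T2.

Local Notation lie h := (T2 h \o T1 h).

(** Correct any preimage f of x under L by an element g of the kernel of L with
A g = - Am f, which exists since A is onto. *)
Lemma dirichlet_lift x : exists p, [/\ dom Am p, Am p = 0 & L p = x].
Proof.
have [f fD <-] := surjL (I : [set: dE] x).
have [Rs [_ Rdom _]] := resA.
have [[gD Lg] Ag] := Rdom (Am f).
exists (1 *: f + Rs (Am f)); split; first by apply: (proj2 (dom_subspace Am)).
  rewrite linear_onP// scale1r.
  by move: Ag; rewrite scale0r sub0r /= => {1}<-; rewrite addNr.
by rewrite linear_onP// scale1r Lg addr0.
Qed.

Lemma T1_inj1 h f : 0 <= h -> T1 h (inj1 dE f) = inj1 dE (T h f).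
Proof.
apply: (generator_intertwine genA genA1 (J := inj1 dE)); first exact: inj1_continuous.
by move=> {}f [fD Lf].
Qed.

(** The vector (p, x) is in the kernel of A1, hence fixed, and (0, x) is the
difference of (p, x) and (p, 0). *)
Lemma T1_lift h x p : 0 <= h -> dom Am p -> Am p = 0 -> L p = x ->
  T1 h (inj2 E x) = (p - T h p, x).
Proof.
move=> h0 pD Ap Lp.
have fixp : T1 h (p, x) = (p, x).
  apply: (generator_kernel genA1) => //=.
  by rewrite Ap.
have -> : inj2 E x = (p, x) - inj1 dE p by congr pair; rewrite /= ?subrr ?subr0.
by rewrite linB fixp T1_inj1//; congr pair; rewrite /= subr0.
Qed.

(** This is p - T(h) p for the lift p of x. Read off T1, it is at once
seen to be independent of the choice of p and bounded in x. *)
Definition lift_defect h x := (T1 h (inj2 E x)).1.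

Lemma T1E h z : 0 <= h -> T1 h z = (T h z.1 + lift_defect h z.2, z.2).
Proof.
move=> h0; have [p [pD Ap Lp]] := dirichlet_lift z.2.
have {1}-> : z = inj1 dE z.1 + inj2 E z.2.
  by case: z {pD Ap Lp} => a b; congr pair; rewrite /= ?addr0 ?add0r.
rewrite linD T1_inj1// /lift_defect (T1_lift h0 pD Ap Lp).
by congr pair; rewrite /= add0r.
Qed.

Lemma T2E h z : 0 <= h -> T2 h z = (z.1, S h z.2).
Proof.
move=> h0; have {1}-> : z = inj1 dE z.1 + inj2 E z.2.
  by case: z => a b; congr pair; rewrite /= ?addr0 ?add0r.
have B0 := linear_on0 B (dom_subspace B).
rewrite linD (generator_kernel genA2) //=; first last.
- by rewrite B0.
- by case: (dom_subspace B).
rewrite (generator_intertwine genB genA2 (J := @inj2 K E dE))//; last exact: inj2_continuous.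
by congr pair; rewrite /= ?addr0 ?add0r.
Qed.

(** Membership of the lifts in the Favard class is pointwise boundedness of the
family lift_defect h / h. *)
Lemma lift_defect_bounded : exists2 q : K, 0 <= q &
  forall h, 0 <= h <= 1 -> bounded_by (lift_defect h) (q * h).
Proof.
pose I := {h : K | 0 < h <= 1}.
pose f (i : I) (x : dE) := (sval i)^-1 *: lift_defect (sval i) x.
have [|[h hP]|x|q q0 fq] := @uniform_boundedness R k dE E I f.
- move=> i a x y; rewrite /f /lift_defect linearP linearP/=.
  by rewrite !scalerDr !scalerA mulrC.
- have /andP[h0 _] := hP.
  have T1c : continuous (T1 h) by case: (proj1 genA1) => + _ _ _; apply; exact: ltW.
  have [c c0 cb] := continuous_bounded_by T1c.
  have hi0 : 0 <= h^-1 by rewrite invr_ge0 ltW.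
  exists (h^-1 * c); first by rewrite mulr_ge0.
  move=> x; rewrite /f /= normrZ ger0_norm// -mulrA ler_wpM2l//.
  rewrite (le_trans (norm_fst_le _))// (le_trans (cb _))// ler_wpM2l//.
  by rewrite (le_trans (norm_pair_le _))//= normr0 add0r.
- have [p [pD Ap Lp]] := dirichlet_lift x.
  have [c cub] := favA pD.
  have fc i : `|f i x| <= c.
    case: i => h hP; have /andP[h0 _] := hP; apply: cub; exists h => //.
    rewrite /f /lift_defect /= (T1_lift (ltW h0) pD Ap Lp) normrZ gtr0_norm ?invr_gt0//.
    by rewrite distrC.
  have one01 : 0 < (1 : K) <= 1 by rewrite ltr01 lexx.
  by exists c => //; exact: le_trans (normr_ge0 _) (fc (exist _ 1 one01)).
exists q => // h /andP[h0 h1] x.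
move: h0; rewrite le_eqVlt => /predU1P[<-|h0].
  by rewrite mulr0 mul0r /lift_defect (semigroup0 (proj1 genA1))/= normr0.
have hP : 0 < h <= 1 by rewrite h0.
have := fq (exist _ h hP) x; rewrite /f /= normrZ gtr0_norm ?invr_gt0// ler_pdivrMl//.
by rewrite mulrA (mulrC h).
Qed.

Lemma lie_splitting_stable t : 0 <= t -> exists2 C : K, 0 <= C &
  \forall n \near \oo, forall j, (j <= n)%N ->
    bounded_by (iter j (lie (t / n%:R))) C.
Proof.
move=> t0.
have [q q0 Qq] := lift_defect_bounded.
have [M M1 TM] := semigroup_locally_bounded (proj1 genA) t.
have [N N1 SN] := semigroup_locally_bounded (proj1 genB) t.
have M0 : 0 <= M by rewrite (le_trans ler01).
have N0 : 0 <= N by rewrite (le_trans ler01).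
exists (t * (M * (q * N)) + M + N); first by rewrite !addr_ge0// !mulr_ge0.
have := cvg_step t0 (@small_times_le R k _ ltr01).
apply: filterS2 (nbhs_infty_gt 0) => n n0 n1 j jn.
have nK0 : 0 < n%:R :> K by rewrite ltr0n.
have h0 : 0 <= t / n%:R by rewrite divr_ge0// ltW.
apply: (triangular_stable (proj1 genA) (proj1 genB) h0 (Q := lift_defect (t / n%:R))) => //.
- by move=> z; rewrite /= T1E// T2E.
- by rewrite mulrA ler_pdivrMr// mulrC ler_wpM2l// ler_nat.
- by apply: Qq; rewrite h0.
Qed.

End BoundaryFeedback.

(** * Consistency and convergence *)

(** The a1 and a2 below are the derivatives of the two factors, and w1, w0 the
vectors obtained from w by the inner factor and by the limit semigroup. *)
Lemma lie_local_error (K : numFieldType) (V : lmodType K) (f : {linear V -> V})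
    (h : K) (w w1 w0 a1 a2 : V) :
  f w1 - w0 = f (w1 - w - h *: a1) + h *: (f a1 - a1) + (f w - w - h *: a2)
     - (w0 - w - h *: (a1 + a2)).
Proof.
rewrite !(linB f) (linZ f) scalerBr scalerDr.
by rewrite -telescope3 (addrC (h *: a2)) -!sub_sub_common.
Qed.

Section LieSplitting.
Variables (R : realType) (k : scalar_kind).
Local Notation K := (scalars R k).
Variables (E dE : completeNormedModType K).
Variables (Am : operator E E) (B : operator dE dE) (L : linear_on dE (dom Am)).
Variables (T0 T1 T2 : K -> {linear (E * dE)%type -> (E * dE)%type}).
Hypothesis genA0 : generates (calA0 B L) T0.
Hypothesis genA1 : generates (calA1 L) T1.
Hypothesis genA2 : generates (calA2 E B) T2.

Local Notation lie h := (T2 h \o T1 h).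

(** A1 T0(s)z and A2 T0(s)z are the two components of A0 T0(s)z, so all three curves
are continuous in s. *)
Lemma lie_consistency z t : 0 <= t -> dom (calA0 B L) z ->
  forall e : K, 0 < e -> \forall n \near \oo, forall s, 0 <= s <= t ->
   `|(lie (t / n%:R)) (T0 s z) - T0 (t / n%:R) (T0 s z)| <= t / n%:R * e.
Proof.
move=> t0 zD e e0.
have [M M1 TM] := semigroup_locally_bounded (proj1 genA2) t.
have M0 : 0 <= M by rewrite (le_trans ler01).
have D0 : 0 < M + 3%:R by rewrite ltr_wpDl.
have e'0 := divr_gt0 e0 D0; set e' := e / _ in e'0.
have orbD s : 0 <= s <= t -> dom (calA0 B L) (T0 s z).
  by case/andP=> s0 _; case: (generator_invariant genA0 s0 zD).
have orbc s : 0 <= s <= t -> (fun s => calA0 B L (T0 s z)) @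
    within [set s : K | 0 <= s] (nbhs s) --> calA0 B L (T0 s z).
  by case/andP=> s0 _; exact: generator_orbit_cvg.
have orb1 s (sP : 0 <= s <= t) : (calA1 L \o (fun s => T0 s z)) @
    within [set s : K | 0 <= s] (nbhs s) --> calA1 L (T0 s z).
  have fstc : continuous (fun w : E * dE => inj1 dE w.1).
    by move=> w; apply: (continuous_comp cvg_fst (@inj1_continuous _ _ _ _)).
  exact: (cvg_comp _ _ (orbc s sP) (fstc _)).
have orb2 s (sP : 0 <= s <= t) : (calA2 E B \o (fun s => T0 s z)) @
    within [set s : K | 0 <= s] (nbhs s) --> calA2 E B (T0 s z).
  have sndc : continuous (fun w : E * dE => inj2 E w.2).
    by move=> w; apply: (continuous_comp cvg_snd (@inj2_continuous _ _ _ _)).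
  exact: (cvg_comp _ _ (orbc s sP) (sndc _)).
have inc0 := generator_increment_uniform genA0 orbD orbc e'0.
have D1 s : 0 <= s <= t -> dom (calA1 L) (T0 s z).
  by move=> /orbD[].
have D2 s : 0 <= s <= t -> dom (calA2 E B) (T0 s z).
  by move=> /orbD[].
have inc1 := generator_increment_uniform genA1 D1 orb1 e'0.
have inc2 := generator_increment_uniform genA2 D2 orb2 e'0.
have osc := semigroup_near0_uniform (proj1 genA2) orb1 e'0.
near=> n.
have n0 : (0 < n)%N by near: n; exact: nbhs_infty_gt.
have nK0 : 0 < n%:R :> K by rewrite ltr0n.
have h0 : 0 <= t / n%:R by rewrite divr_ge0// ltW.
have hP : 0 <= t / n%:R <= t.
  by rewrite h0/= ler_pdivrMr// ler_peMr// ler1n.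
have i0 s : 0 <= s <= t ->
    `|T0 (t / n%:R) (T0 s z) - T0 s z - (t / n%:R) *: calA0 B L (T0 s z)| <= t / n%:R * e'.
  by move: s; near: n; exact: (cvg_step t0 inc0).
have i1 s : 0 <= s <= t ->
    `|T1 (t / n%:R) (T0 s z) - T0 s z - (t / n%:R) *: calA1 L (T0 s z)| <= t / n%:R * e'.
  by move: s; near: n; exact: (cvg_step t0 inc1).
have i2 s : 0 <= s <= t ->
    `|T2 (t / n%:R) (T0 s z) - T0 s z - (t / n%:R) *: calA2 E B (T0 s z)| <= t / n%:R * e'.
  by move: s; near: n; exact: (cvg_step t0 inc2).
have i3 s : 0 <= s <= t ->
    `|T2 (t / n%:R) (calA1 L (T0 s z)) - calA1 L (T0 s z)| <= e'.
  by move: s; near: n; exact: (cvg_step t0 osc).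
move=> s st; move: (i0 s st) (i1 s st) (i2 s st) (i3 s st) => {i0 i1 i2 i3} i0 i1 i2 i3.
move: i0; rewrite (proj2 (calA0_sum B L)) => i0.
rewrite /= (lie_local_error _ (t / n%:R) (T0 s z) _ _ (calA1 L (T0 s z)) (calA2 E B (T0 s z))).
have -> : t / n%:R * e = M * (t / n%:R * e') + t / n%:R * e' + t / n%:R * e' + t / n%:R * e'.
  rewrite -four_shares; congr (_ * _).
  by rewrite /e' divfK// gt_eqF.
rewrite (le_trans (ler_normB _ _))// lerD//.
rewrite (le_trans (ler_normD _ _))// lerD//.
rewrite (le_trans (ler_normD _ _))// lerD//.
  by rewrite (le_trans (TM _ hP _))// ler_wpM2l.
by rewrite normrZ ger0_norm// ler_wpM2l.
Unshelve. all: by end_near. Qed.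

Lemma lie_splitting_cvg t (C : K) : 0 <= t -> 0 <= C ->
  (\forall n \near \oo, forall j, (j <= n)%N ->
    bounded_by (iter j (lie (t / n%:R))) C) ->
  forall z, (fun n : nat => iter n (lie (t / n%:R)) z) @ \oo --> T0 t z.
Proof.
move=> t0 C0 stable.
have VB n : {morph T2 (t / n%:R) \o T1 (t / n%:R) : x y / x - y}.
  by move=> x y /=; rewrite !linB.
have iterB n j x y : iter j (lie (t / n%:R)) (x - y) =
   iter j (lie (t / n%:R)) x - iter j (lie (t / n%:R)) y.
  by elim: j => [//|j IHj]; rewrite !iterS IHj VB.
have iterD n j x y : iter j (lie (t / n%:R)) (x + y) =
   iter j (lie (t / n%:R)) x + iter j (lie (t / n%:R)) y.
  by have := iterB n j (x + y) y; rewrite addrK => ->; rewrite subrK.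
have on_dom z e : dom (calA0 B L) z -> 0 < e ->
    \forall n \near \oo, `|T0 t z - iter n (lie (t / n%:R)) z| <= e.
  move=> zD e0; have D0 : 0 < 1 + t * C by rewrite ltr_pwDl// mulr_ge0.
  have cons := lie_consistency t0 zD (divr_gt0 e0 D0).
  near=> n.
  have consn s : 0 <= s <= t -> `|(lie (t / n%:R)) (T0 s z) -
      T0 (t / n%:R) (T0 s z)| <= t / n%:R * (e / (1 + t * C)).
    by move: s; near: n.
  have n0 : (0 < n)%N by near: n; exact: nbhs_infty_gt.
  have nK0 : 0 < n%:R :> K by rewrite ltr0n.
  have h0 : 0 <= t / n%:R by rewrite divr_ge0// ltW.
  have nh : n%:R * (t / n%:R) = t by rewrite mulrC divfK// gt_eqF.
  have := @iter_bound_telescope K (E * dE)%type (lie (t / n%:R))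
     (fun j => T0 (j%:R * (t / n%:R)) z) n C (t / n%:R * (e / (1 + t * C))) (VB n) C0.
  rewrite mul0r (semigroup0 (proj1 genA0)) nh distrC => telescope.
  apply: le_trans (telescope _ _) _.
  - by near: n.
  - move=> j jn.
    have jP : 0 <= j%:R * (t / n%:R) <= t.
      by rewrite mulr_ge0//= -[leRHS]nh ler_wpM2r// ler_nat ltnW.
    rewrite -natr1 mulrDl mul1r (addrC _ (t / n%:R)) (semigroupD (proj1 genA0)) ?mulr_ge0//.
    exact: consn.
  - rewrite mul5_shuffle_div nh.
    by rewrite ler_pdivrMr// ler_wpM2l ?(ltW e0)// lerDr.
move=> z; apply/cvgrPdist_le => e e0.
have [M M1 TM] := semigroup_locally_bounded (proj1 genA0) t.
have M0 : 0 <= M by rewrite (le_trans ler01).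
have MC : 0 < 1 + (M + C) by rewrite ltr_pwDl// addr_ge0.
have e20 : 0 < e / 2%:R by rewrite divr_gt0.
have [z' z'D zz'] := generator_dense genA0 z (divr_gt0 e20 MC).
near=> n.
have nC : bounded_by (iter n (lie (t / n%:R))) C.
  have : forall j, (j <= n)%N -> bounded_by (iter j (lie (t / n%:R))) C.
    by near: n.
  exact.
have z'n : `|T0 t z' - iter n (lie (t / n%:R)) z'| <= e / 2%:R.
  by near: n; exact: on_dom.
rewrite -(subrK z' z); set d := z - z' in zz' *.
rewrite iterD.
rewrite linD opprD addrACA (le_trans (ler_normD _ _))// -(half_halves e) lerD//.
rewrite (le_trans (ler_normB _ _))// (le_trans (lerD (TM _ _ _) (nC _)))//.
  by rewrite t0 lexx.
rewrite -mulrDl (le_trans (ler_wpM2l _ zz'))//; first by rewrite addr_ge0.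
by rewrite mulrA ler_pdivrMr// mulrC ler_wpM2l ?(ltW e20)// lerDr.
Unshelve. all: by end_near. Qed.

(** The inner half steps of consecutive cycles merge into full steps. *)
Lemma strang_iter (W : Type) (a b : W -> W) n z :
  iter n.+1 (a \o b \o a) z = a (iter n (b \o (a \o a)) (b (a z))).
Proof. by elim: n => [//|n IH]; rewrite iterS IH. Qed.

(** Up to the first and the last half step, which tend to the identity, the
iteration is V(h)^(n-1) T2(h), which differs from V(h)^n by V(h)^(n-1) applied to a
vector that tends to 0. *)
Lemma strang_splitting_cvg t (C : K) : 0 <= t -> 0 <= C ->
  (\forall n \near \oo, forall j, (j <= n)%N ->
    bounded_by (iter j (lie (t / n%:R))) C) ->
  forall z, (fun n : nat =>
     iter n (T1 (t / (2 * n)%:R) \o T2 (t / n%:R) \o T1 (t / (2 * n)%:R)) z) @ \oo --> T0 t z.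
Proof.
move=> t0 C0 stable z.
have lie_cvg := lie_splitting_cvg t0 C0 stable (z := z).
have iterB n j x y : iter j (lie (t / n%:R)) (x - y) =
   iter j (lie (t / n%:R)) x - iter j (lie (t / n%:R)) y.
  by elim: j => [//|j IHj]; rewrite !iterS IHj /= !linB.
apply/cvgrPdist_le => e e0.
have [M M1 TM] := semigroup_locally_bounded (proj1 genA1) t.
have [N N1 TN] := semigroup_locally_bounded (proj1 genA2) t.
have M0 : 0 < M by rewrite (lt_le_trans ltr01).
have N0 : 0 < N by rewrite (lt_le_trans ltr01).
have e30 : 0 < e / 3%:R by rewrite divr_gt0.
have D0 : 0 < 1 + M * (C * (N * M)) by rewrite ltr_pwDl// !mulr_ge0// ltW.
have half n : t / (2 * n)%:R = t / n%:R / 2%:R.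
  by rewrite mulnC natrM invfM mulrA.
have steps := cvg_step t0.
have near_half x d : 0 < d -> \forall n \near \oo, `|T1 (t / (2 * n)%:R) x - x| <= d.
  move=> d0; have nx := semigroup_near0 (proj1 genA1) x d0.
  have [r r0 rP] := small_timesP nx.
  have : \forall n \near \oo, t / n%:R <= r by exact: (steps _ (small_times_le r0)).
  apply: filterS => n nr; rewrite half; apply: rP; first by rewrite !divr_ge0.
  by rewrite (le_trans _ nr)// ler_pdivrMr// ler_peMr ?divr_ge0// ler1n.
near=> n.
have n0 : (0 < n)%N by near: n; exact: nbhs_infty_gt.
have nK0 : 0 < n%:R :> K by rewrite ltr0n.
have h0 : 0 <= t / n%:R by rewrite divr_ge0// ltW.
have hP : 0 <= t / n%:R <= t by rewrite h0/= ler_pdivrMr// ler_peMr// ler1n.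
have h20 : 0 <= t / (2 * n)%:R by rewrite divr_ge0.
have h2P : 0 <= t / (2 * n)%:R <= t.
  by rewrite h20/= ler_pdivrMr ?ltr0n ?muln_gt0// ler_peMr// ler1n muln_gt0.
have VC : forall j, (j <= n)%N -> bounded_by (iter j (lie (t / n%:R))) C.
  by near: n.
have lien : `|T0 t z - iter n (lie (t / n%:R)) z| <= e / 3%:R / M.
  by near: n; move: lie_cvg => /cvgr_dist_le; apply; rewrite divr_gt0.
have zn : `|T1 (t / (2 * n)%:R) z - z| <= e / 3%:R / (1 + M * (C * (N * M))).
  by near: n; apply: near_half; rewrite divr_gt0.
have wn : `|T1 (t / (2 * n)%:R) (T0 t z) - T0 t z| <= e / 3%:R.
  by near: n; apply: near_half.
have halves x : T1 (t / (2 * n)%:R) (T1 (t / (2 * n)%:R) x) = T1 (t / n%:R) x.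
  by rewrite -(semigroupD (proj1 genA1))// half half_halves.
have nm : n.-1.+1 = n by rewrite prednK.
have -> : iter n (T1 (t / (2 * n)%:R) \o T2 (t / n%:R) \o T1 (t / (2 * n)%:R)) z =
    T1 (t / (2 * n)%:R) (iter n.-1 (lie (t / n%:R))
      (T2 (t / n%:R) (T1 (t / (2 * n)%:R) z))).
  rewrite -{1}nm strang_iter; congr (T1 _ _).
  by apply: eq_iter => x /=; rewrite halves.
set v := iter n.-1 _ _; set a := T1 (t / (2 * n)%:R).
have Vn : iter n (lie (t / n%:R)) z - v =
    iter n.-1 (lie (t / n%:R)) (T2 (t / n%:R) (a (a z - z))).
  by rewrite /a linB halves linB iterB -iterSr nm.
have -> : T0 t z - a v = (T0 t z - a (T0 t z)) +
   a (T0 t z - iter n (lie (t / n%:R)) z) +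
   a (iter n (lie (t / n%:R)) z - v).
  by rewrite !(linB a) !subrKA.
rewrite (third_sum e) (le_trans (ler_normD _ _))// lerD//.
  rewrite (le_trans (ler_normD _ _))// lerD//; first by rewrite distrC.
  by rewrite (le_trans (TM _ h2P _))// mulrC -ler_pdivlMr.
rewrite Vn (le_trans (TM _ h2P _))//.
rewrite (le_trans (ler_wpM2l (ltW M0) (VC _ (leq_pred n) _)))//.
rewrite (le_trans (ler_wpM2l (ltW M0) (ler_wpM2l C0 (TN _ hP _))))//.
rewrite (le_trans (ler_wpM2l (ltW M0) (ler_wpM2l C0 (ler_wpM2l (ltW N0) (TM _ h2P _)))))//.
have P0 : 0 <= M * (C * (N * M)) by rewrite !mulr_ge0// ltW.
have -> : M * (C * (N * (M * `|a z - z|))) = M * (C * (N * M)) * `|a z - z|.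
  by rewrite -!mulrA.
rewrite (le_trans (ler_wpM2l P0 zn))// mulrCA -[leRHS]mulr1 ler_wpM2l ?(ltW e30)//.
by rewrite ler_pdivrMr// mul1r lerDr.
Unshelve. all: by end_near. Qed.

End LieSplitting.

Theorem corollary3p9 (R : realType) (k : scalar_kind)
  (E dE : completeNormedModType (scalars R k))
  (Am : operator E E) (B : operator dE dE) (L : linear_on dE (dom Am))
  (T : scalars R k -> {linear E -> E})
  (S : scalars R k -> {linear dE -> dE})
  (T0 T1 T2 : scalars R k -> {linear (E * dE)%type -> (E * dE)%type})
  (genA : generates (restrict_ker L) T)
  (surjL : set_surj (dom Am) [set: dE] L)
  (closedAmL : closed [set p : E * (E * dE) |
                        dom Am p.1 /\ (Am p.1, L p.1) = p.2])
  (genB : generates B S)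
  (resA : resolvent_set (restrict_ker L) 0)
  (favA : dom Am `<=` Fav1 T)
  (genA0 : generates (calA0 B L) T0)
  (genA1 : generates (calA1 L) T1)
  (genA2 : generates (calA2 E B) T2) :
  forall (z : E * dE) (t : scalars R k), 0 <= t ->
    (fun n : nat => iter n (T2 (t / n%:R) \o T1 (t / n%:R)) z) @ \oo --> T0 t z
    /\
    (fun n : nat =>
       iter n (T1 (t / (2 * n)%:R) \o T2 (t / n%:R) \o T1 (t / (2 * n)%:R)) z)
      @ \oo --> T0 t z.
Proof.
move=> z t t0.
have [C C0 stable] := lie_splitting_stable genA surjL genB resA favA genA1 genA2 t0.
split; first exact: (lie_splitting_cvg genA0 genA1 genA2 t0 C0 stable).
exact: (strang_splitting_cvg genA0 genA1 genA2 t0 C0 stable).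
Qed.
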